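(* Let $\mathfrak g:=i(A_\Theta^\infty)_{sa}\cap\ker(\tau)$, identified with the Lie algebra of inner *-derivations of $A_\Theta^\infty$ via $\tilde a\mapsto\operatorname{ad}_{\tilde a}$. Let $\nabla$ be a connection on $\chi_\Theta$ such that $$\nabla_{\operatorname{ad}_{\tilde a}}(Y)=\tilde aY+\mu(\tilde a)(Y)\qquad(\tilde a\in\mathfrak g,\ Y\in\chi_\Theta)$$ for some $\mu\in\operatorname{Hom}_{\mathbb R}(\mathfrak g,\operatorname{End}_{A_\Theta^\infty}(\chi_\Theta))$. Let $R(X,Y):=\nabla_Y\nabla_X-\nabla_X\nabla_Y+\nabla_{[X,Y]}$ for $X,Y\in\mathcal D_\Theta$ be its curvature form. Then for all $X\in\mathcal D_\Theta$ and all $\tilde a\in\mathfrak g$, $$R(\operatorname{ad}_{\tilde a},X)=[\nabla_X,\mu(\tilde a)]-\mu(X\cdot\tilde a),$$ where $[\nabla_X,\mu(\tilde a)]=\nabla_X\mu(\tilde a)-\mu(\tilde a)\nabla_X$ is the commutator in $\operatorname{End}_{\mathbb C}(\chi_\Theta)$. Moreover, $R(\operatorname{ad}_{\tilde a},\operatorname{ad}_{\tilde b})=0$ for all $\tilde a,\tilde b\in\mathfrak g$ if and only if $\mu$ is a Lie algebra homomorphism, i.e. $\mu([\tilde a,\tilde b])=[\mu(\tilde a),\mu(\tilde b)]$ for all $\tilde a,\tilde b\in\mathfrak g$.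
   Context: Noncommutative torus: $\Theta$ is a real skew-symmetric $n\times n$ matrix and $A_\Theta$ is the universal C*-algebra generated by unitaries $u_1,\dots,u_n$ with $u_ju_k=e^{2\pi i\Theta_{jk}}u_ku_j$. $A_\Theta^\infty$ is the dense unital *-subalgebra of smooth vectors for the canonical $\mathbb T^n$-action, $\partial_1,\dots,\partial_n$ are the associated commuting partial derivatives ($\partial_j u_k=2\pi i\,\delta_{jk}u_k$), which are *-derivations of $A_\Theta^\infty$, $\tau$ is the unique $\mathbb T^n$-invariant tracial state, and $(A_\Theta^\infty)_{sa}$ is the set of self-adjoint elements. $\operatorname{ad}_a(b)=ab-ba$. Standing assumption: $\Theta$ is ''generically transcendental'', which is used in the following form: $A_\Theta$ is simple (so the center of $A_\Theta^\infty$ is $\mathbb C$), and the real Lie algebra $\mathcal D_\Theta$ (with commutator bracket) of all *-derivations $A_\Theta^\infty\to A_\Theta^\infty$ (derivations $\delta$ with $\delta(b^* )=\delta(b)^*$) is the $\mathbb R$-linear span of $\partial_1,\dots,\partial_n$ and the inner *-derivations. The inner *-derivations are exactly the $\operatorname{ad}_{\tilde a}$ for a unique $\tilde a\in\mathfrak g=i(A_\Theta^\infty)_{sa}\cap\ker\tau$ (skew-adjoint elements of trace zero). For $X\in\mathcal D_\Theta$, $a\in A_\Theta^\infty$, write $X\cdot a=X(a)$; one has $X\cdot\tilde a\in\mathfrak g$ for $\tilde a\in\mathfrak g$. $\chi_\Theta=(A_\Theta^\infty)^n$ is the free left $A_\Theta^\infty$-module of rank $n$; $\operatorname{End}_{A_\Theta^\infty}(\chi_\Theta)$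 is the algebra of left-module endomorphisms, with product composition and commutator as Lie bracket. Connection: an $\mathbb R$-bilinear map $\nabla:\mathcal D_\Theta\times\chi_\Theta\to\chi_\Theta$, $(X,Y)\mapsto\nabla_XY$, with $\nabla_X(aY)=(X\cdot a)Y+a\nabla_XY$ for all $a\in A_\Theta^\infty$, $Y\in\chi_\Theta$. *)

(* Defs.v *)
From HB Require Import structures.
From mathcomp Require Import all_boot all_order all_algebra.
From mathcomp Require Import all_classical all_reals all_analysis.
From mathcomp Require Import complex ssrAC ring.

Set Implicit Arguments.
Unset Strict Implicit.
Unset Printing Implicit Defensive.

Import Order.TTheory GRing.Theory Num.Theory.
Import numFieldNormedType.Exports.
Local Open Scope classical_set_scope.
Local Open Scope ring_scope.
Local Open Scope complex_scope.

HB.mixin Record isStarAlgebra (R : realType) A of GRing.Algebra R[i] A := {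
  star : A -> A ;
  starK : involutive star ;
  starD : {morph star : a b / a + b} ;
  starZ : forall (c : R[i]) a, star (c *: a) = conjc c *: star a ;
  starM : forall a b, star (a * b) = star b * star a
}.

#[short(type="starAlgType")]
HB.structure Definition StarAlgebra (R : realType) :=
  {A of GRing.Algebra R[i] A & isStarAlgebra R A}.

Section StarAlgebraTheory.
Variables (R : realType) (A : starAlgType R).
Implicit Types a b : A.

Lemma star_is_additive : additive (@star R A).
Proof.
move=> a b; rewrite starD; congr (_ + _).
have s0 : star (0 : A) = 0 by apply: (addIr (star 0)); rewrite -starD !add0r.
by apply/eqP; rewrite -addr_eq0 -starD addrC subrr s0.
Qed.

HB.instance Definition _ := GRing.isAdditive.Build A A (@star R A) star_is_additive.

Lemma star0 : star (0 : A) = 0. Proof. exact: raddf0. Qed.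
Lemma starN a : star (- a) = - star a. Proof. exact: raddfN. Qed.
Lemma starB a b : star (a - b) = star a - star b. Proof. exact: raddfB. Qed.

Lemma star1 : star (1 : A) = 1.
Proof. by rewrite -[LHS]mulr1 -{2}[1]starK -starM mulr1 starK. Qed.

Definition is_star_derivation (d : A -> A) : Prop :=
  [/\ linear d,
      forall a b, d (a * b) = d a * b + a * d b &
      forall b, d (star b) = star (d b)].

Definition star_derivation_pred : {pred A -> A} :=
  fun d => `[< is_star_derivation d >].

Record starDer := StarDer {
  starDer_fun :> A -> A ;
  _ : starDer_fun \in star_derivation_pred }.

HB.instance Definition _ := [isSub for starDer_fun].
HB.instance Definition _ := [Choice of starDer by <:].

Lemma starDerP (d : starDer) : is_star_derivation d.
Proof. exact/asboolP/(valP d). Qed.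

Lemma starDer_linear (d : starDer) : linear d.
Proof. by have [] := starDerP d. Qed.

Lemma starDerM (d : starDer) a b : d (a * b) = d a * b + a * d b.
Proof. by have [] := starDerP d. Qed.

Lemma starDer_star (d : starDer) a : d (star a) = star (d a).
Proof. by have [] := starDerP d. Qed.

Lemma linear0_D_Z (V W : lmodType R[i]) (f : V -> W) : linear f ->
  [/\ f 0 = 0, {morph f : x y / x + y} & forall c x, f (c *: x) = c *: f x].
Proof.
move=> fL; have f0 : f 0 = 0.
  by have := fL (-1) 0 0; rewrite scaler0 addr0 scaleN1r addrC subrr.
split=> // [x y|c x]; first by have := fL 1 x y; rewrite !scale1r.
by have := fL c x 0; rewrite !addr0 f0 addr0.
Qed.

Lemma star_derivation_zmod_closed : zmod_closed star_derivation_pred.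
Proof.
split=> [|d e /asboolP[dL dM dS] /asboolP[eL eM eS]]; apply/asboolP; split.
- by move=> c x y; rewrite /= scaler0 addr0.
- by move=> a b /=; rewrite mul0r mulr0 addr0.
- by move=> b /=; rewrite raddf0.
- move=> c x y; rewrite !fctE dL eL scalerBr opprD !addrA; congr (_ + _).
  by rewrite addrAC.
- move=> a b; rewrite !fctE dM eM mulrBl mulrBr opprD !addrA; congr (_ + _).
  by rewrite addrAC.
- by move=> b; rewrite !fctE dS eS raddfB.
Qed.

HB.instance Definition _ := GRing.isZmodClosed.Build (A -> A)
  star_derivation_pred star_derivation_zmod_closed.
HB.instance Definition _ := [SubChoice_isSubZmodule of starDer by <:].

Lemma starDer_scale_subproof (r : R) (d : starDer) :
  (fun a => r%:C *: d a) \in star_derivation_pred.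
Proof.
have [dL dM dS] := starDerP d; have [_ dD dZ] := linear0_D_Z dL.
apply/asboolP; split=> [c x y|a b|b].
- by rewrite dD dZ scalerDr !scalerA mulrC.
- by rewrite dM scalerDr scalerAl scalerAr.
- by rewrite dS starZ conjc_real.
Qed.

Definition starDer_scale (r : R) (d : starDer) : starDer :=
  StarDer (starDer_scale_subproof r d).

Lemma starDer_ext (d e : starDer) : d =1 e -> d = e.
Proof. by move=> de; apply/val_inj/funext. Qed.

Fact starDer_scaleA r s (d : starDer) :
  starDer_scale r (starDer_scale s d) = starDer_scale (r * s) d.
Proof. by apply: starDer_ext => a /=; rewrite scalerA rmorphM. Qed.
Fact starDer_scale1 : left_id 1 starDer_scale.
Proof. by move=> d; apply: starDer_ext => a /=; rewrite rmorph1 scale1r. Qed.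
Fact starDer_scaleDr : right_distributive starDer_scale +%R.
Proof.
by move=> r d e; apply: starDer_ext => a; rewrite /= !fctE scalerDr.
Qed.
Fact starDer_scaleDl (d : starDer) :
  {morph starDer_scale^~ d : r s / r + s}.
Proof.
by move=> r s; apply: starDer_ext => a; rewrite /= !fctE rmorphD scalerDl.
Qed.

HB.instance Definition _ := GRing.Zmodule_isLmodule.Build R starDer
  starDer_scaleA starDer_scale1 starDer_scaleDr starDer_scaleDl.

Lemma der_bracket_subproof (d e : starDer) :
  (fun a => d (e a) - e (d a)) \in star_derivation_pred.
Proof.
have [_ dD dZ] := linear0_D_Z (starDer_linear d).
have [_ eD eZ] := linear0_D_Z (starDer_linear e).
apply/asboolP; split=> [c x y|a b|b].
- rewrite eD eZ !dD !dZ !eD !eZ scalerBr opprD !addrA; congr (_ + _).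
  by rewrite addrAC.
- rewrite !starDerM dD eD !starDerM mulrBl mulrBr.
  rewrite !opprD (AC ((2*2)*(2*2)) (((1*5)*(4*8))*((2*7)*(3*6)))) /= !subrr.
  by rewrite !addr0.
- by rewrite !starDer_star raddfB.
Qed.

Definition der_bracket (d e : starDer) : starDer :=
  StarDer (der_bracket_subproof d e).

End StarAlgebraTheory.

Record trace (R : realType) (A : starAlgType R) := Trace {
  trace_fun :> A -> R[i] ;
  trace_linear : scalar trace_fun ;
  traceC : forall a b, trace_fun (a * b) = trace_fun (b * a)
}.

Section SkewTraceless.
Variables (R : realType) (A : starAlgType R) (tau : trace A).
Implicit Types a b : A.

Lemma linear0_D_Z_trace :
  [/\ tau 0 = 0, {morph tau : x y / x + y} & forall c x, tau (c *: x) = c * tau x].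
Proof. exact: (@linear0_D_Z R A (R[i] : lmodType _) tau (@trace_linear _ _ tau)). Qed.

Definition skew_traceless_pred : {pred A} :=
  fun a => (star a == - a) && (tau a == 0).

Record skew_traceless := SkewTraceless {
  skew_traceless_val :> A ;
  _ : skew_traceless_val \in skew_traceless_pred }.

HB.instance Definition _ := [isSub for skew_traceless_val].
HB.instance Definition _ := [Choice of skew_traceless by <:].

Lemma skew_traceless_star (a : skew_traceless) : star (a : A) = - (a : A).
Proof. by have /andP[/eqP] := valP a. Qed.

Lemma skew_traceless_tr0 (a : skew_traceless) : tau a = 0.
Proof. by have /andP[_ /eqP] := valP a. Qed.

Lemma skew_traceless_intro a :
  star a = - a -> tau a = 0 -> a \in skew_traceless_pred.
Proof. by move=> aS a0; apply/andP; split; apply/eqP. Qed.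

Lemma skew_traceless_zmod_closed : zmod_closed skew_traceless_pred.
Proof.
have [t0 tD tZ] := linear0_D_Z_trace.
split=> [|a b /andP[/eqP aS /eqP a0] /andP[/eqP bS /eqP b0]].
  by apply: skew_traceless_intro => //; rewrite star0 oppr0.
apply: skew_traceless_intro; first by rewrite starB aS bS opprB opprK addrC.
by rewrite tD a0 add0r -scaleN1r tZ b0 mulr0.
Qed.

HB.instance Definition _ := GRing.isZmodClosed.Build A
  skew_traceless_pred skew_traceless_zmod_closed.
HB.instance Definition _ := [SubChoice_isSubZmodule of skew_traceless by <:].

Lemma skew_scale_subproof (r : R) (a : skew_traceless) :
  r%:C *: (a : A) \in skew_traceless_pred.
Proof.
have [t0 tD tZ] := linear0_D_Z_trace.
apply: skew_traceless_intro.
  by rewrite starZ conjc_real skew_traceless_star scalerN.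
by rewrite tZ skew_traceless_tr0 mulr0.
Qed.

Definition skew_scale (r : R) (a : skew_traceless) : skew_traceless :=
  SkewTraceless (skew_scale_subproof r a).

Fact skew_scaleA r s (a : skew_traceless) : skew_scale r (skew_scale s a) = skew_scale (r * s) a.
Proof. by apply: val_inj; rewrite /= scalerA rmorphM. Qed.
Fact skew_scale1 : left_id 1 skew_scale.
Proof. by move=> a; apply: val_inj; rewrite /= rmorph1 scale1r. Qed.
Fact skew_scaleDr : right_distributive skew_scale +%R.
Proof. by move=> r a b; apply: val_inj; rewrite /= scalerDr. Qed.
Fact skew_scaleDl (a : skew_traceless) : {morph skew_scale^~ a : r s / r + s}.
Proof. by move=> r s; apply: val_inj; rewrite /= rmorphD scalerDl. Qed.

HB.instance Definition _ := GRing.Zmodule_isLmodule.Build R skew_traceless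
  skew_scaleA skew_scale1 skew_scaleDr skew_scaleDl.

Lemma skew_bracket_subproof (a b : skew_traceless) :
  (a : A) * (b : A) - (b : A) * (a : A) \in skew_traceless_pred.
Proof.
have [t0 tD tZ] := linear0_D_Z_trace.
apply: skew_traceless_intro.
  by rewrite starB !starM !skew_traceless_star !mulrNN opprB.
by rewrite tD -scaleN1r tZ mulN1r traceC subrr.
Qed.

Definition skew_bracket (a b : skew_traceless) : skew_traceless :=
  SkewTraceless (skew_bracket_subproof a b).

Lemma ad_subproof (a : skew_traceless) :
  (fun b : A => (a : A) * b - b * (a : A)) \in @star_derivation_pred R A.
Proof.
apply/asboolP; split=> [c x y|b c|b].
- rewrite mulrDr mulrDl -scalerAr -scalerAl scalerBr opprD !addrA; congr (_ + _).
  by rewrite addrAC.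
- by rewrite mulrBl mulrBr !mulrA addrA subrK.
- rewrite starB !starM skew_traceless_star mulrN mulNr opprK.
  by rewrite addrC.
Qed.

Definition ad (a : skew_traceless) : starDer A := StarDer (ad_subproof a).

Lemma der_act_subproof (tauX : forall (X : starDer A) b, tau (X b) = 0)
    (X : starDer A) (a : skew_traceless) : X a \in skew_traceless_pred.
Proof.
apply: skew_traceless_intro; last exact: tauX.
rewrite -starDer_star skew_traceless_star.
have [_ _ XZ] := linear0_D_Z (starDer_linear X).
by rewrite -scaleN1r XZ scaleN1r.
Qed.

Definition der_act tauX (X : starDer A) (a : skew_traceless) : skew_traceless :=
  SkewTraceless (der_act_subproof tauX X a).

End SkewTraceless.

Section Connections.
Variables (R : realType) (A : starAlgType R) (n : nat).

(* Real scalars act on a module over A through [r%:C%:A : A]. *)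
Record connection := Connection {
  nabla :> starDer A -> 'rV[A]_n -> 'rV[A]_n ;
  nabla_linearl : forall (r : R) X X' Y,
    nabla (r *: X + X') Y = r%:C%:A *: nabla X Y + nabla X' Y ;
  nabla_linearr : forall (r : R) X Y Y',
    nabla X (r%:C%:A *: Y + Y') = r%:C%:A *: nabla X Y + nabla X Y' ;
  nabla_leibniz : forall X a Y, nabla X (a *: Y) = X a *: Y + a *: nabla X Y
}.

(* The opposite of the usual sign convention. *)
Definition curvature (D : connection) (X Y : starDer A) (Z : 'rV[A]_n) : 'rV[A]_n :=
  D Y (D X Z) - D X (D Y Z) + D (der_bracket X Y) Z.

Definition commutator (f g : 'rV[A]_n -> 'rV[A]_n) (Z : 'rV[A]_n) : 'rV[A]_n :=
  f (g Z) - g (f Z).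

Definition real_linear_to_End (V : lmodType R)
    (mu : V -> {linear 'rV[A]_n -> 'rV[A]_n}) : Prop :=
  forall (r : R) a b Y, mu (r *: a + b) Y = r%:C%:A *: mu a Y + mu b Y.

End Connections.

(* The norm is real-valued and is kept separate from the library's normed
   modules: an abstract type cannot inherit both from [nzRingType] and from
   [normedZmodType] below [numDomainType]. *)
HB.mixin Record isCStarAlgebra (R : realType) A of StarAlgebra R A := {
  cnorm : A -> R ;
  cnorm0_eq0 : forall a : A, cnorm a = 0 -> a = 0 ;
  cnormD : forall a b : A, cnorm (a + b) <= cnorm a + cnorm b ;
  cnormZ : forall (c : R[i]) (a : A), (cnorm (c *: a))%:C = `|c| * (cnorm a)%:C ;
  cnormM : forall a b : A, cnorm (a * b) <= cnorm a * cnorm b ;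
  cnorm_star_mul : forall a : A, cnorm (star a * a) = cnorm a ^+ 2 ;
  cnorm_complete : forall u : nat -> A,
    (forall e, 0 < e -> exists N : nat, forall m k : nat,
        (N <= m)%N -> (N <= k)%N -> cnorm (u m - u k) < e) ->
    exists l, (fun k => cnorm (u k - l)) @ \oo --> (0 : R)
}.

(* Unital and nonzero. *)
#[short(type="cstarType")]
HB.structure Definition CStarAlgebra (R : realType) :=
  {A of StarAlgebra R A & isCStarAlgebra R A}.

Definition norm_cvg (R : realType) (A : cstarType R) T (F : set_system T)
  (f : T -> A) (a : A) : Prop := (fun x => cnorm (f x - a)) @ F --> (0 : R).

Definition is_star_hom (R : realType) (A B : starAlgType R) (f : A -> B) : Prop :=
  [/\ linear f, f 1 = 1, forall a b, f (a * b) = f a * f b &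
      forall a, f (star a) = star (f a)].

Section CStarTheory.
Variables (R : realType) (A : cstarType R).
Implicit Types (a b : A) (r : R).

Lemma cnormZr r a : cnorm (r%:C *: a) = `|r| * cnorm a.
Proof.
apply: complexI; rewrite cnormZ rmorphM; congr (_ * _).
by rewrite normc_def /= expr0n addr0 sqrtr_sqr.
Qed.

Lemma cnorm0 : cnorm (0 : A) = 0.
Proof. by rewrite -(scale0r 0) -[0]/(0%:C) cnormZr normr0 mul0r. Qed.

Lemma cnormN a : cnorm (- a) = cnorm a.
Proof.
by rewrite -scaleN1r -[-1 in LHS](rmorphN1 (real_complex R)) cnormZr normrN1 mul1r.
Qed.

Lemma cnorm_ge0 a : 0 <= cnorm a.
Proof.
have := cnormD a (- a); rewrite subrr cnorm0 cnormN -mulr2n.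
by rewrite pmulrn_lge0.
Qed.

Lemma cnormB a b : cnorm (a - b) <= cnorm a + cnorm b.
Proof. by rewrite -(cnormN b) cnormD. Qed.

Lemma cdistC a b : cnorm (a - b) = cnorm (b - a).
Proof. by rewrite -opprB cnormN. Qed.

Lemma cnorm_gt0 a : a != 0 -> 0 < cnorm a.
Proof.
by move=> a0; rewrite lt_def cnorm_ge0 andbT; apply: contra a0 => /eqP/cnorm0_eq0->.
Qed.

Lemma cnorm1 : cnorm (1 : A) = 1.
Proof.
have n0 : cnorm (1 : A) != 0 by rewrite gt_eqF// cnorm_gt0// oner_neq0.
have := cnorm_star_mul (1 : A); rewrite star1 mulr1 => h.
by apply: (mulfI n0); rewrite mulr1 -expr2 -h.
Qed.

Lemma cnorm_star a : cnorm (star a) = cnorm a.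
Proof.
suff le (b : A) : cnorm b <= cnorm (star b).
  by apply: le_anti; rewrite le andbT -{2}[a]starK le.
have [->|b0] := eqVneq b 0; first by rewrite raddf0.
rewrite -(ler_pM2r (cnorm_gt0 b0)) -expr2 -cnorm_star_mul; exact: cnormM.
Qed.

Section Convergence.
Variables (T : Type) (F : set_system T).
Implicit Types f g : T -> A.

Lemma ncvg_squeeze {FF : Filter F} f a (u : T -> R) :
  (\forall x \near F, cnorm (f x - a) <= u x) -> u @ F --> 0 -> norm_cvg F f a.
Proof.
move=> fu u0; apply: (squeeze_cvgr _ (cvg_cst 0) u0).
by apply: filterS fu => x ->; rewrite cnorm_ge0.
Qed.

Lemma ncvg_near_eq {FF : Filter F} f g a :
  (\forall x \near F, f x = g x) -> norm_cvg F f a -> norm_cvg F g a.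
Proof.
by move=> fg fa; apply: ncvg_squeeze fa; apply: filterS fg => x ->.
Qed.

Lemma ncvg_cst {FF : Filter F} a : norm_cvg F (fun _ => a) a.
Proof. by rewrite /norm_cvg subrr cnorm0; exact: cvg_cst. Qed.

Lemma ncvgD {FF : Filter F} f g a b :
  norm_cvg F f a -> norm_cvg F g b -> norm_cvg F (fun x => f x + g x) (a + b).
Proof.
move=> fa gb; apply: (@ncvg_squeeze _ _ _ (fun x => cnorm (f x - a) + cnorm (g x - b))).
  by apply: nearW => x; rewrite opprD addrACA cnormD.
by rewrite -[0]addr0; exact: cvgD.
Qed.

Lemma ncvgM {FF : Filter F} f g a b :
  norm_cvg F f a -> norm_cvg F g b -> norm_cvg F (fun x => f x * g x) (a * b).
Proof.
move=> fa gb; apply: (@ncvg_squeeze _ _ _ (fun x => cnorm (f x - a) * cnorm (g x - b)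
   + cnorm (f x - a) * cnorm b + cnorm a * cnorm (g x - b))).
  apply: nearW => x.
  have -> : f x * g x - a * b =
      (f x - a) * (g x - b) + (f x - a) * b + a * (g x - b).
    by rewrite -mulrDr subrK mulrBl mulrBr addrA subrK.
  by rewrite (le_trans (cnormD _ _))// lerD ?cnormM// (le_trans (cnormD _ _))// lerD ?cnormM.
have -> : 0 = 0 * 0 + 0 * cnorm b + cnorm a * 0 :> R by rewrite !(mul0r,mulr0,addr0).
apply: cvgD; last by apply: cvgM => //; exact: cvg_cst.
by apply: cvgD; apply: cvgM => //; exact: cvg_cst.
Qed.

Lemma ncvg_unique {FF : ProperFilter F} f a b :
  norm_cvg F f a -> norm_cvg F f b -> a = b.
Proof.
move=> fa fb; apply/eqP; rewrite -subr_eq0; apply/eqP/cnorm0_eq0.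
have : (fun=> cnorm (a - b)) @ F --> (0 : R).
  apply: (@squeeze_cvgr _ _ _ _ (fun=> 0) (fun x => cnorm (f x - a) + cnorm (f x - b))).
  - apply: nearW => x; rewrite cnorm_ge0 /=.
    by rewrite (cdistC (f x)) (le_trans _ (cnormD _ _))// addrA subrK.
  - exact: cvg_cst.
  - by rewrite -[0]addr0; exact: cvgD.
by move/(cvg_unique _ (cvg_cst _)); apply; exact: Rhausdorff.
Qed.
End Convergence.

End CStarTheory.

Lemma ncvg_bounded (R : realType) (A B : cstarType R) (phi : A -> B) (M : R) T
    (F : set_system T) {FF : Filter F} (f : T -> A) a :
  {morph phi : x y / x - y} -> (forall x, cnorm (phi x) <= M * cnorm x) ->
  norm_cvg F f a -> norm_cvg F (fun x => phi (f x)) (phi a).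
Proof.
move=> phiB phiM fa.
apply: (@ncvg_squeeze _ _ _ _ _ _ _ (fun x => M * cnorm (f x - a))).
  by apply: nearW => x; rewrite -phiB phiM.
by rewrite -[0 in X in _ --> X](mulr0 M); apply: cvgM => //; exact: cvg_cst.
Qed.

Section SquareRoot.
Variables (R : realType) (A : cstarType R).
Implicit Types a b : A.

Lemma ncvg_star T (F : set_system T) {FF : Filter F} (f : T -> A) a :
  norm_cvg F f a -> norm_cvg F (fun x => star (f x)) (star a).
Proof.
apply: (@ncvg_bounded _ _ _ _ 1) => [x y|x]; first by rewrite raddfB.
by rewrite mul1r cnorm_star.
Qed.

Lemma ncvgZ T (F : set_system T) {FF : Filter F} (f : T -> A) (c : R[i]) a :
  norm_cvg F f a -> norm_cvg F (fun x => c *: f x) (c *: a).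
Proof.
apply: (@ncvg_bounded _ _ _ _ (complex.Re `|c|)) => [x y|x].
  by rewrite scalerBr.
by rewrite -lecR cnormZ rmorphM normc_def.
Qed.

Let half : R[i] := (2^-1 : R)%:C.

Lemma half_double a : half *: a + half *: a = a.
Proof.
by rewrite -scalerDl -rmorphD -[2^-1]mul1r -splitr rmorph1 scale1r.
Qed.

(* [1 - s] has a self-adjoint square root commuting with whatever commutes
   with [s], obtained by iterating [y |-> (s + y^2) / 2]. *)
Lemma sqrt_one_sub (s : A) : star s = s -> cnorm s < 1 ->
  exists w : A, [/\ star w = w, w * w = 1 - s &
    forall b, b * s = s * b -> b * w = w * b].
Proof.
move=> sS s1; set rho := cnorm s in s1.
have rho0 : 0 <= rho := cnorm_ge0 s.
pose f y := half *: (s + y * y); pose u k := iter k f 0.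
have nhalf x : cnorm (half *: x) = 2^-1 * cnorm x.
  by rewrite cnormZr ger0_norm// invr_ge0.
have u_le k : cnorm (u k) <= rho.
  elim: k => [|k IH]; first by rewrite /u /= cnorm0.
  rewrite /u iterS -/(u k) /f nhalf ler_pdivrMl//.
  rewrite (le_trans (cnormD _ _))// mulr_natl mulr2n lerD//.
  rewrite (le_trans (cnormM _ _))// -[leRHS]mulr1 ler_pM ?cnorm_ge0//.
  by rewrite (le_trans IH) ?ltW.
have f_contr y z : cnorm y <= rho -> cnorm z <= rho ->
    cnorm (f y - f z) <= rho * cnorm (y - z).
  move=> yr zr; rewrite /f -scalerBr nhalf ler_pdivrMl//.
  have -> : s + y * y - (s + z * z) = y * (y - z) + (y - z) * z.
    by rewrite mulrBr mulrBl addrA subrK opprD addrACA subrr add0r.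
  rewrite (le_trans (cnormD _ _))// mulrA mulr_natl mulrnAl mulr2n lerD//.
    by rewrite (le_trans (cnormM _ _))// ler_wpM2r// cnorm_ge0.
  by rewrite (le_trans (cnormM _ _))// mulrC ler_wpM2r// cnorm_ge0.
have u_dist k m : cnorm (u (k + m)%N - u k) <= rho ^+ k * rho.
  elim: k => [|k IH]; first by rewrite add0n expr0 mul1r subr0.
  rewrite addSn /u !iterS -!/(u _) (le_trans (f_contr _ _ _ _))//.
  by rewrite exprS -mulrA ler_wpM2l.
have [e e0|l ul] := @cnorm_complete R A u.
  have : (fun k => rho ^+ k) @ \oo --> (0 : R).
    by apply: cvg_expr; rewrite ger0_norm.
  move=> /cvgrPdist_lt/(_ (e / 2)); rewrite divr_gt0// => /(_ isT)[N _ NP].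
  exists N => m k Nm Nk.
  have d j : (N <= j)%N -> cnorm (u j - u N) < e / 2.
    move=> Nj; rewrite -(subnKC Nj) (le_lt_trans (u_dist _ _))//.
    have := NP N (leqnn N); rewrite /= sub0r normrN ger0_norm ?exprn_ge0// => h.
    rewrite (le_lt_trans _ h)// -[leRHS]mulr1 ler_wpM2l ?exprn_ge0//.
    exact: ltW.
  rewrite (splitr e) -[u m](subrK (u N)) -addrA (le_lt_trans (cnormD _ _))//.
  by rewrite ltrD ?d// cdistC d.
have {}ul : norm_cvg \oo u l := ul.
have fl : f l = l.
  apply: (@ncvg_unique _ _ _ \oo _ (fun k => u k.+1)).
    apply: ncvgZ; apply: ncvgD; first exact: ncvg_cst.
    exact: ncvgM.
  by move: ul; rewrite /norm_cvg -cvg_shiftS.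
have lS : star l = l.
  apply: (@ncvg_unique _ _ _ \oo _ u) => //.
  apply: (ncvg_near_eq _ (ncvg_star ul)); apply: nearW; elim=> [|k IH].
    by rewrite /u /= raddf0.
  by rewrite /u iterS -/(u k) /f starZ starD sS starM IH conjc_real.
have lC b : b * s = s * b -> b * l = l * b.
  move=> bs; apply: (@ncvg_unique _ _ _ \oo _ (fun k => b * u k)).
    by apply: ncvgM => //; exact: ncvg_cst.
  apply: (@ncvg_near_eq _ _ _ _ _ (fun k => u k * b)); last first.
    by apply: ncvgM => //; exact: ncvg_cst.
  apply: nearW; elim=> [|k IH]; first by rewrite /u /= mul0r mulr0.
  rewrite /u iterS -/(u k) /f -scalerAl -scalerAr mulrDl mulrDr bs.
  by rewrite -mulrA IH !mulrA IH.
exists (1 - l); split=> [||b bs].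
- by rewrite starB star1 lS.
- have h : s + l * l = l + l by rewrite -[LHS]half_double -/(f l) fl.
  have -> : s = l + l - l * l by rewrite -h addrK.
  by rewrite mulrBl mul1r mulrBr mulr1 -[LHS]addrA -opprD addrA.
- by rewrite mulrBl mulrBr mul1r mulr1 lC.
Qed.

End SquareRoot.

(* *-homomorphisms are automatically continuous. *)
Section StarHomBounded.
Variables (R : realType) (A B : cstarType R) (f : A -> B).
Hypothesis f_hom : is_star_hom f.

Lemma star_hom_sub : {morph f : x y / x - y}.
Proof.
have [fL _ _ _] := f_hom; have [_ fD fZ] := linear0_D_Z fL.
by move=> x y; rewrite fD -scaleN1r fZ scaleN1r.
Qed.

Lemma star_mul_add_i (x w : A) : star x = x -> star w = w -> x * w = w * x ->
  star (x + 'i *: w) * (x + 'i *: w) = x * x + w * w.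
Proof.
move=> xS wS xw; rewrite starD starZ xS wS.
have -> : conjc 'i = - 'i :> R[i] by apply/eqP; rewrite eq_complex /= oppr0 !eqxx.
rewrite mulrDl !mulrDr -!scalerAl -!scalerAr scalerA mulNr.
have -> : ('i * 'i : R[i]) = -1.
  by apply/eqP; rewrite eq_complex /= !(mul0r,mulr0,mulr1,add0r,addr0,oppr0) !eqxx.
rewrite opprK scale1r xw scaleNr addrA; congr (_ + _).
by rewrite -[in LHS]addrA subrr addr0.
Qed.

Lemma star_hom_sa_le1 (x : A) : star x = x -> cnorm x < 1 -> cnorm (f x) <= 1.
Proof.
have [fL f1 fM fS] := f_hom; have [_ fD fZ] := linear0_D_Z fL.
move=> xS x1.
have [||w [wS ww wC]] := @sqrt_one_sub R A (x * x).
- by rewrite starM xS.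
- by rewrite (le_lt_trans (cnormM _ _))// mulr_ilt1// cnorm_ge0.
have xw : x * w = w * x by apply: wC; rewrite mulrA.
pose z := x + 'i *: w.
have zz : star z * z = 1.
  by rewrite /z star_mul_add_i// ww addrC subrK.
have nz : cnorm (f z) = 1.
  apply/eqP; rewrite -(@eqrXn2 _ 2)// ?cnorm_ge0// expr1n.
  by rewrite -cnorm_star_mul -fS -fM zz f1 cnorm1.
have -> : x = (2^-1 : R)%:C *: (z + star z).
  rewrite /z starD starZ xS wS.
  have -> : conjc 'i = - 'i :> R[i] by apply/eqP; rewrite eq_complex /= oppr0 !eqxx.
  rewrite scaleNr addrACA subrr addr0 scalerDr.
  by rewrite half_double.
rewrite fZ cnormZr ger0_norm ?invr_ge0// ler_pdivrMl// mulr1 fD.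
by rewrite (le_trans (cnormD _ _))// fS cnorm_star nz.
Qed.

Lemma star_hom_bounded (a : A) : cnorm (f a) <= 2 * cnorm a.
Proof.
have [fL f1 fM fS] := f_hom; have [f0 fD fZ] := linear0_D_Z fL.
have sa x : star x = x -> cnorm (f x) <= 2 * cnorm x.
  move=> xS; have [->|x0] := eqVneq x 0; first by rewrite f0 !cnorm0 mulr0.
  have c0 : 0 < 2 * cnorm x by rewrite mulr_gt0// cnorm_gt0.
  have := @star_hom_sa_le1 ((2 * cnorm x)^-1%:C *: x).
  rewrite starZ conjc_real xS => /(_ erefl).
  rewrite fZ !cnormZr ger0_norm ?invr_ge0 ?(ltW c0)// => h.
  rewrite -[leRHS]mulr1 -ler_pdivrMl//; apply: h.
  by rewrite invfM -mulrA mulVf ?gt_eqF ?cnorm_gt0// mulr1 invf_lt1// ltr1n.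
rewrite -(@ler_pXn2r _ 2) ?nnegrE ?cnorm_ge0 ?mulr_ge0 ?cnorm_ge0//.
rewrite -cnorm_star_mul -fS -fM (le_trans (sa _ _))//.
  by rewrite starM starK.
rewrite cnorm_star_mul exprMn ler_wpM2r ?exprn_ge0 ?cnorm_ge0//.
by rewrite -natrX ler_nat.
Qed.

Lemma ncvg_star_hom T (F : set_system T) {FF : Filter F} (u : T -> A) a :
  norm_cvg F u a -> norm_cvg F (fun x => f (u x)) (f a).
Proof. exact: (ncvg_bounded star_hom_sub star_hom_bounded). Qed.

End StarHomBounded.

(* exp(2 pi i x) *)
Definition cis2pi (R : realType) (x : R) : R[i] :=
  cos (2 * pi * x) +i* sin (2 * pi * x).

Section Cis.
Variable R : realType.

Lemma cis2piD (x y : R) : cis2pi (x + y) = cis2pi x * cis2pi y.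
Proof.
rewrite /cis2pi mulrDr cosD sinD; apply/eqP; rewrite eq_complex /= eqxx /=.
by rewrite addrC [X in X + _]mulrC [X in _ + X]mulrC addrC mulrC [X in _ + X]mulrC.
Qed.

Lemma cis2pi0 : cis2pi (0 : R) = 1.
Proof. by rewrite /cis2pi mulr0 cos0 sin0. Qed.

Lemma conj_cis2pi (x : R) : conjc (cis2pi x) = cis2pi (- x).
Proof. by rewrite /cis2pi mulrN cosN sinN. Qed.

Lemma conj_cis2piK (x : R) : conjc (cis2pi x) * cis2pi x = 1.
Proof. by rewrite conj_cis2pi -cis2piD addNr cis2pi0. Qed.

End Cis.

Definition nct_relations (R : realType) n (Theta : 'M[R]_n) (A : starAlgType R)
    (u : 'I_n -> A) : Prop :=
  (forall j, star (u j) * u j = 1 /\ u j * star (u j) = 1) /\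
  (forall j k, u j * u k = cis2pi (Theta j k) *: (u k * u j)).

(* The universal C*-algebra generated by unitaries subject to the relations;
   uniqueness of the morphisms says that the [nct_gen j] generate. *)
Record nctorus (R : realType) n (Theta : 'M[R]_n) := NCTorus {
  nct_alg :> cstarType R ;
  nct_gen : 'I_n -> nct_alg ;
  nct_gen_rel : nct_relations Theta nct_gen ;
  nct_universal : forall (B : cstarType R) (v : 'I_n -> B),
    nct_relations Theta v ->
    exists! f : nct_alg -> B, is_star_hom f /\ forall j, f (nct_gen j) = v j
}.

Section GaugeAction.
Variables (R : realType) (n : nat) (Theta : 'M[R]_n) (T : nctorus Theta).
Implicit Types (a b : T) (t s : 'rV[R]_n).

Lemma gauge_subproof t :
  nct_relations Theta (fun j => cis2pi (t 0 j) *: nct_gen T j).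
Proof.
have [uU uR] := nct_gen_rel T; split=> [j|j k].
  rewrite starZ -!scalerAl -!scalerAr !scalerA [cis2pi _ * _]mulrC.
  by rewrite conj_cis2piK !scale1r; exact: uU.
rewrite -!scalerAl -!scalerAr uR !scalerA; congr (_ *: _).
by rewrite mulrC mulrAC mulrA.
Qed.

(* The action of the torus T^n = R^n / Z^n, parametrized by R^n. *)
Definition gauge t : T -> T := sval (cid (@nct_universal _ _ _ T _ _ (gauge_subproof t))).

Lemma gauge_hom t : is_star_hom (gauge t).
Proof. by rewrite /gauge; case: cid => f /= [[]]. Qed.

Lemma gauge_gen t j : gauge t (nct_gen T j) = cis2pi (t 0 j) *: nct_gen T j.
Proof. by rewrite /gauge; case: cid => f /= [[]]. Qed.

Lemma gauge_unique t (f : T -> T) : is_star_hom f ->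
  (forall j, f (nct_gen T j) = cis2pi (t 0 j) *: nct_gen T j) -> gauge t = f.
Proof. by rewrite /gauge; case: cid => g /= [_ gU] fh fg; apply: gU. Qed.

Lemma gaugeD s t a : gauge (s + t) a = gauge s (gauge t a).
Proof.
have [sL s1 sM sS] := gauge_hom s; have [tL t1 tM tS] := gauge_hom t.
have [_ _ sZ] := linear0_D_Z sL.
suff -> : gauge (s + t) = gauge s \o gauge t by [].
apply: gauge_unique => [|j]; last first.
  by rewrite /= gauge_gen sZ gauge_gen scalerA mxE cis2piD mulrC.
split=> [c x y|||] /=; first by rewrite tL sL.
- by rewrite t1 s1.
- by move=> x y; rewrite tM sM.
- by move=> x; rewrite tS sS.
Qed.

Lemma gauge0 a : gauge 0 a = a.
Proof.
suff -> : gauge 0 = id by [].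
by apply: gauge_unique => // j; rewrite mxE cis2pi0 scale1r.
Qed.

End GaugeAction.

Section Smoothness.
Variables (R : realType) (A : cstarType R) (n : nat).
Implicit Types (f g : 'rV[R]_n -> A) (j : 'I_n) (t : 'rV[R]_n).

Definition diff_quotient f j t (h : R) : A :=
  (h^-1)%:C *: (f (t + h *: delta_mx 0 j) - f t).

Definition is_partial j f g : Prop :=
  forall t, norm_cvg 0^' (diff_quotient f j t) (g t).

(* All partial derivatives up to order k exist and are continuous. *)
Fixpoint class_C (k : nat) f : Prop :=
  (forall t, norm_cvg (nbhs t) f (f t)) /\
  (if k is k'.+1 then forall j, exists2 g, is_partial j f g & class_C k' g
   else True).

Lemma is_partial_unique j f g1 g2 :
  is_partial j f g1 -> is_partial j f g2 -> g1 = g2.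
Proof. by move=> p1 p2; apply/funext => t; exact: ncvg_unique (p1 t) (p2 t). Qed.

Lemma is_partial_cst j a : is_partial j (fun _ => a) (fun _ => 0).
Proof.
move=> t; apply: (@ncvg_near_eq _ _ _ _ _ (fun _ => 0)); last exact: ncvg_cst.
by apply: nearW => h; rewrite /diff_quotient subrr scaler0.
Qed.

Lemma is_partialD j f1 f2 g1 g2 : is_partial j f1 g1 -> is_partial j f2 g2 ->
  is_partial j (fun t => f1 t + f2 t) (fun t => g1 t + g2 t).
Proof.
move=> p1 p2 t; apply: (ncvg_near_eq _ (ncvgD (p1 t) (p2 t))).
by apply: nearW => h; rewrite /diff_quotient -scalerDr opprD addrACA.
Qed.

Lemma is_partialZ j (c : R[i]) f g : is_partial j f g ->
  is_partial j (fun t => c *: f t) (fun t => c *: g t).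
Proof.
move=> p t; apply: (ncvg_near_eq _ (ncvgZ c (p t))).
by apply: nearW => h; rewrite /diff_quotient -scalerBr !scalerA mulrC.
Qed.

Lemma is_partial_star j f g : is_partial j f g ->
  is_partial j (fun t => star (f t)) (fun t => star (g t)).
Proof.
move=> p t; apply: (ncvg_near_eq _ (ncvg_star (p t))).
by apply: nearW => h; rewrite /diff_quotient starZ conjc_real starB.
Qed.

Lemma is_partial_continuous j f g t : is_partial j f g ->
  norm_cvg 0^' (fun h : R => f (t + h *: delta_mx 0 j)) (f t).
Proof.
move=> p; apply: (@ncvg_near_eq _ _ _ _ _
    (fun h : R => h%:C%:A * diff_quotient f j t h + f t)).
  near=> h; rewrite /diff_quotient -scalerAl mul1r scalerA -rmorphM mulfV.
    by rewrite rmorph1 scale1r subrK.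
  by near: h; exact: nbhs_dnbhs_neq.
rewrite -[f t in X in norm_cvg _ _ X]add0r; apply: ncvgD; last exact: ncvg_cst.
rewrite -(mul0r (g t)); apply: ncvgM; last exact: p.
rewrite /norm_cvg; have : (fun h : R => `|h|) @ 0^' --> (0 : R).
  by rewrite -[0 in X in _ --> X](@normr0 _ R); apply: cvg_norm; exact: cvg_within.
apply: cvg_trans; apply: near_eq_cvg; apply: nearW => h.
by rewrite subr0 cnormZr cnorm1 mulr1.
Unshelve. all: by end_near. Qed.

Lemma is_partialM j f1 f2 g1 g2 : is_partial j f1 g1 -> is_partial j f2 g2 ->
  is_partial j (fun t => f1 t * f2 t) (fun t => g1 t * f2 t + f1 t * g2 t).
Proof.
move=> p1 p2 t; have c2 := is_partial_continuous t p2.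
apply: (ncvg_near_eq _ (ncvgD (ncvgM (p1 t) c2) (ncvgM (ncvg_cst (f1 t)) (p2 t)))).
apply: nearW => h; rewrite /diff_quotient -scalerAl -scalerAr -scalerDr.
by rewrite mulrBl mulrBr addrA subrK.
Qed.

Lemma class_C_continuous k f t : class_C k f -> norm_cvg (nbhs t) f (f t).
Proof. by case: k => [|k] []. Qed.

Lemma class_CW k f : class_C k.+1 f -> class_C k f.
Proof.
elim: k f => [|k IH] f; first by case.
case=> fc fp; split=> // j; have [g pg gC] := fp j.
by exists g => //; exact: IH.
Qed.

Lemma class_C_cst k a : class_C k (fun _ => a).
Proof.
elim: k a => [|k IH] a; first by split=> // t; exact: ncvg_cst.
split=> [t|j]; first exact: ncvg_cst.
by exists (fun _ => 0); [exact: is_partial_cst|exact: IH].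
Qed.

Lemma class_CD k f1 f2 :
  class_C k f1 -> class_C k f2 -> class_C k (fun t => f1 t + f2 t).
Proof.
elim: k f1 f2 => [|k IH] f1 f2 [c1 p1] [c2 p2].
  by split=> // t; exact: ncvgD.
split=> [t|j]; first exact: ncvgD.
have [g1 pg1 gC1] := p1 j; have [g2 pg2 gC2] := p2 j.
exists (fun t => g1 t + g2 t); last exact: IH.
exact: is_partialD.
Qed.

Lemma class_CZ k (c : R[i]) f : class_C k f -> class_C k (fun t => c *: f t).
Proof.
elim: k f => [|k IH] f [fc fp]; first by split=> // t; exact: ncvgZ.
split=> [t|j]; first exact: ncvgZ.
have [g pg gC] := fp j; exists (fun t => c *: g t); last exact: IH.
exact: is_partialZ.
Qed.

Lemma class_C_star k f : class_C k f -> class_C k (fun t => star (f t)).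
Proof.
elim: k f => [|k IH] f [fc fp]; first by split=> // t; exact: ncvg_star.
split=> [t|j]; first exact: ncvg_star.
have [g pg gC] := fp j; exists (fun t => star (g t)); last exact: IH.
exact: is_partial_star.
Qed.

Lemma class_CM k f1 f2 :
  class_C k f1 -> class_C k f2 -> class_C k (fun t => f1 t * f2 t).
Proof.
elim: k f1 f2 => [|k IH] f1 f2 C1 C2; have [c1 p1] := C1; have [c2 p2] := C2.
  by split=> // t; exact: ncvgM.
split=> [t|j]; first exact: ncvgM.
have [g1 pg1 gC1] := p1 j; have [g2 pg2 gC2] := p2 j.
exists (fun t => g1 t * f2 t + f1 t * g2 t); first exact: is_partialM.
by apply: class_CD; apply: IH => //; exact: class_CW.
Qed.

End Smoothness.

Section SmoothAlgebra.
Variables (R : realType) (n : nat) (Theta : 'M[R]_n) (T : nctorus Theta).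
Implicit Types (a b : T) (j : 'I_n).

Definition orbit_map a (t : 'rV[R]_n) : T := gauge t a.

Definition smooth : {pred T} := fun a => `[< forall k, class_C k (orbit_map a) >].

Lemma orbit_mapD a b : orbit_map (a + b) = fun t => orbit_map a t + orbit_map b t.
Proof.
apply/funext => t; have [gL _ _ _] := gauge_hom T t.
by have [_ gD _] := linear0_D_Z gL; exact: gD.
Qed.

Lemma orbit_mapZ (c : R[i]) a : orbit_map (c *: a) = fun t => c *: orbit_map a t.
Proof.
apply/funext => t; have [gL _ _ _] := gauge_hom T t.
by have [_ _ gZ] := linear0_D_Z gL; exact: gZ.
Qed.

Lemma orbit_mapM a b : orbit_map (a * b) = fun t => orbit_map a t * orbit_map b t.
Proof. by apply/funext => t; have [_ _ gM _] := gauge_hom T t; exact: gM. Qed.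

Lemma orbit_map_star a : orbit_map (star a) = fun t => star (orbit_map a t).
Proof. by apply/funext => t; have [_ _ _ gS] := gauge_hom T t; exact: gS. Qed.

Lemma orbit_map1 : orbit_map 1 = fun _ => 1.
Proof. by apply/funext => t; have [] := gauge_hom T t. Qed.

Lemma smooth_subalg_closed : subalg_closed smooth.
Proof.
split=> [|c a b /asboolP aC /asboolP bC|a b /asboolP aC /asboolP bC].
- by apply/asboolP => k; rewrite orbit_map1; exact: class_C_cst.
- apply/asboolP => k; rewrite orbit_mapD orbit_mapZ.
  by apply: class_CD; [exact: class_CZ|exact: bC].
- by apply/asboolP => k; rewrite orbit_mapM; exact: class_CM.
Qed.

HB.instance Definition _ := GRing.isSubalgClosed.Build R[i] T smooth smooth_subalg_closed.

Record smooth_alg := SmoothElt { smooth_val :> T ; _ : smooth_val \in smooth }.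

HB.instance Definition _ := [isSub for smooth_val].
HB.instance Definition _ := [Choice of smooth_alg by <:].
HB.instance Definition _ := [SubChoice_isSubAlgebra of smooth_alg by <:].

Lemma smooth_star_subproof (a : smooth_alg) : star (a : T) \in smooth.
Proof.
apply/asboolP => k; rewrite orbit_map_star; apply: class_C_star.
by have /asboolP := valP a; apply.
Qed.

Definition smooth_star (a : smooth_alg) : smooth_alg :=
  SmoothElt (smooth_star_subproof a).

Fact smooth_starK : involutive smooth_star.
Proof. by move=> a; apply: val_inj; exact: starK. Qed.
Fact smooth_starD : {morph smooth_star : a b / a + b}.
Proof. by move=> a b; apply: val_inj; exact: starD. Qed.
Fact smooth_starZ (c : R[i]) (a : smooth_alg) :
  smooth_star (c *: a) = conjc c *: smooth_star a.
Proof. by apply: val_inj; exact: starZ. Qed.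
Fact smooth_starM (a b : smooth_alg) :
  smooth_star (a * b) = smooth_star b * smooth_star a.
Proof. by apply: val_inj; exact: starM. Qed.

HB.instance Definition _ := isStarAlgebra.Build R smooth_alg
  smooth_starK smooth_starD smooth_starZ smooth_starM.

(* The derivative at t = 0 of the action along the j-th coordinate, so that it
   maps [nct_gen k] to 2 pi i delta_jk [nct_gen k]; on a non-smooth element
   where the limit does not exist, the value is arbitrary. *)
Definition torus_partial j a : T :=
  xget 0 [set b | norm_cvg 0^' (diff_quotient (orbit_map a) j 0) b].

Lemma torus_partial_eq j a g : is_partial j (orbit_map a) g -> torus_partial j a = g 0.
Proof.
move=> p; rewrite /torus_partial; case: xgetP => [b _ bP|/(_ (g 0))/(_ (p 0))//].
exact: ncvg_unique bP (p 0).
Qed.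

Lemma orbit_partial j a g : is_partial j (orbit_map a) g ->
  orbit_map (torus_partial j a) = g.
Proof.
move=> p; rewrite (torus_partial_eq p); apply/funext => t.
apply: (@ncvg_unique _ _ _ 0^' _ (diff_quotient (orbit_map a) j t)) (p t).
apply: (ncvg_near_eq _ (ncvg_star_hom (gauge_hom T t) (p 0))); apply: nearW => h.
have [gL _ _ _] := gauge_hom T t; have [_ _ gZ] := linear0_D_Z gL.
rewrite /diff_quotient gZ (star_hom_sub (gauge_hom T t)) add0r /orbit_map.
by rewrite gauge0 gaugeD.
Qed.

Lemma smooth_is_partial j (a : smooth_alg) :
  is_partial j (orbit_map a) (orbit_map (torus_partial j a)).
Proof.
have /asboolP/(_ 1%N)[_ /(_ j)[g pg _]] := valP a.
by rewrite (orbit_partial pg).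
Qed.

Lemma torus_partial_subproof j (a : smooth_alg) : torus_partial j a \in smooth.
Proof.
apply/asboolP => k; have /asboolP/(_ k.+1)[_ /(_ j)[g pg gC]] := valP a.
by rewrite (orbit_partial pg).
Qed.

Definition smooth_partial j (a : smooth_alg) : smooth_alg :=
  SmoothElt (torus_partial_subproof j a).

Lemma smooth_partial_star_derivation j :
  smooth_partial j \in @star_derivation_pred R smooth_alg.
Proof.
have g0 a : orbit_map a 0 = a by rewrite /orbit_map gauge0.
apply/asboolP; split=> [c a b|a b|b]; apply: val_inj => /=.
- have : is_partial j (orbit_map (c *: (a : T) + (b : T)))
      (fun t => c *: orbit_map (torus_partial j a) t + orbit_map (torus_partial j b) t).
    rewrite orbit_mapD orbit_mapZ; apply: is_partialD; last exact: smooth_is_partial.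
    by apply: is_partialZ; exact: smooth_is_partial.
  by move/torus_partial_eq => ->; rewrite !g0.
- have : is_partial j (orbit_map ((a : T) * (b : T)))
      (fun t => orbit_map (torus_partial j a) t * orbit_map b t
                + orbit_map a t * orbit_map (torus_partial j b) t).
    by rewrite orbit_mapM; apply: is_partialM; exact: smooth_is_partial.
  by move/torus_partial_eq => ->; rewrite !g0.
- have : is_partial j (orbit_map (star (b : T)))
      (fun t => star (orbit_map (torus_partial j b) t)).
    by rewrite orbit_map_star; apply: is_partial_star; exact: smooth_is_partial.
  by move/torus_partial_eq => ->; rewrite !g0.
Qed.

Definition partial_der j : starDer smooth_alg :=
  StarDer (smooth_partial_star_derivation j).

End SmoothAlgebra.

(* No two-sided norm-closed ideal besides 0 and A (an ideal of a unital algebra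
   is stable under scalars). *)
Definition is_simple (R : realType) (A : cstarType R) : Prop :=
  forall I : set A,
    I 0 -> (forall a b, I a -> I b -> I (a + b)) ->
    (forall a b, I a -> I (a * b) /\ I (b * a)) ->
    (forall (u : nat -> A) l, (forall k, I (u k)) -> norm_cvg \oo u l -> I l) ->
    I = [set 0] \/ I = setT.

Definition is_inner (R : realType) (A : starAlgType R) (Z : starDer A) : Prop :=
  exists b : A, forall a, Z a = b * a - a * b.

(* Positivity and [its1] make this a state of norm one. *)
Record invariant_tracial_state (R : realType) n (Theta : 'M[R]_n)
    (T : nctorus Theta) := InvariantTracialState {
  its_fun :> T -> R[i] ;
  its_linear : scalar its_fun ;
  its1 : its_fun 1 = 1 ;
  its_pos : forall a, 0 <= its_fun (star a * a) ;
  itsC : forall a b, its_fun (a * b) = its_fun (b * a) ;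
  its_gauge : forall t a, its_fun (gauge t a) = its_fun a
}.

(* Generic transcendentality of Theta, in the form of its two consequences:
   A_Theta is simple, and the *-derivations of the smooth subalgebra form the
   real span of the partial derivatives and the inner *-derivations (the latter
   are a subspace, whence a single inner summand). *)
Record generically_transcendental (R : realType) n (Theta : 'M[R]_n)
    (T : nctorus Theta) : Prop := GenericallyTranscendental {
  gt_simple : is_simple T ;
  gt_span : forall X : starDer (smooth_alg T), exists c : 'I_n -> R,
    exists2 Z : starDer (smooth_alg T), is_inner Z &
      X = \sum_j c j *: partial_der T j + Z
}.

Section SmoothTrace.
Variables (R : realType) (n : nat) (Theta : 'M[R]_n) (T : nctorus Theta).
Variable tau : invariant_tracial_state T.
Implicit Types (a b : T) (j : 'I_n).

Lemma its_linear0_D_Z :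
  [/\ tau 0 = 0, {morph tau : x y / x + y} & forall c x, tau (c *: x) = c * tau x].
Proof. exact: (@linear0_D_Z R T (R[i] : lmodType _) tau (@its_linear _ _ _ _ tau)). Qed.

Lemma its_sa_le1 a : star a = a -> cnorm a < 1 -> tau a <= 1.
Proof.
have [t0 tD tZ] := its_linear0_D_Z.
move=> aS a1; have [w [wS ww _]] := sqrt_one_sub aS a1.
have := its_pos tau w; rewrite wS ww tD its1 -scaleN1r tZ mulN1r.
by rewrite subr_ge0.
Qed.

Lemma its_sa_bounded a : star a = a -> `|tau a| <= (2 * cnorm a)%:C.
Proof.
have [t0 tD tZ] := its_linear0_D_Z.
move=> aS; have [->|a0] := eqVneq a 0; first by rewrite t0 normr0 cnorm0 mulr0.
have c0 : 0 < 2 * cnorm a by rewrite mulr_gt0// cnorm_gt0.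
pose x := (2 * cnorm a)^-1%:C *: a.
have xS : star x = x by rewrite starZ conjc_real aS.
have x1 : cnorm x < 1.
  rewrite cnormZr ger0_norm ?invr_ge0 ?(ltW c0)//.
  by rewrite invfM -mulrA mulVf ?gt_eqF ?cnorm_gt0// mulr1 invf_lt1// ltr1n.
have le1 := its_sa_le1 xS x1.
have ge1 : - 1 <= tau x.
  have : tau (- x) <= 1 by apply: its_sa_le1; rewrite ?starN ?xS ?cnormN.
  by rewrite -scaleN1r tZ mulN1r lerNl.
have -> : a = (2 * cnorm a)%:C *: x.
  by rewrite scalerA -rmorphM mulfV ?gt_eqF// rmorph1 scale1r.
have xr : tau x \is Num.real.
  by have := ger_real le1; rewrite [1 \is _]ger0_real // => ->.
rewrite tZ normrM -[(2 * cnorm _)%:C in leRHS]mulr1.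
have C0 : 0 <= (2 * cnorm a)%:C by rewrite (lecR 0) ltW.
have -> : 2 * cnorm ((2 * cnorm a)%:C *: x) = 2 * cnorm a.
  rewrite cnormZr ger0_norm ?(ltW c0)// cnormZr ger0_norm ?invr_ge0 ?(ltW c0)//.
  by congr (2 * _); rewrite mulrA mulfV ?mul1r ?gt_eqF.
rewrite (ger0_norm C0) ler_wpM2l// real_ler_norml//.
by rewrite ge1 le1.
Qed.

Lemma its_bounded a : `|tau a| <= (4 * cnorm a)%:C.
Proof.
have [t0 tD tZ] := its_linear0_D_Z.
pose h : R[i] := (2^-1 : R)%:C.
have nh (z : T) : `|tau (h *: z)| = h * `|tau z|.
  by rewrite tZ normrM ger0_norm// (lecR 0) invr_ge0.
have i2 : 'i * 'i = -1 :> R[i].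
  by apply/eqP; rewrite eq_complex /= !(mul0r,mulr0,mulr1,add0r,addr0,oppr0) !eqxx.
have ic : conjc 'i = - 'i :> R[i] by apply/eqP; rewrite eq_complex /= oppr0 !eqxx.
have ni : `|'i| = 1 :> R[i].
  by rewrite normc_def /= expr0n expr1n add0r sqrtr1.
pose x := a + star a; pose y := 'i *: (a - star a).
have xS : star x = x by rewrite starD starK addrC.
have yS : star y = y.
  by rewrite starZ starB starK ic scaleNr -scalerN opprB.
have aE : a = h *: (x + (- 'i) *: y).
  rewrite /y scalerA mulNr i2 opprK scale1r /x addrACA subrr addr0.
  by rewrite scalerDr half_double.
have nx : cnorm x <= 2 * cnorm a.
  by rewrite (le_trans (cnormD _ _))// cnorm_star mulr2n mulrDl mul1r.
have ny : cnorm y <= 2 * cnorm a.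
  rewrite -lecR cnormZ ni mul1r lecR (le_trans (cnormB _ _))//.
  by rewrite cnorm_star mulr2n mulrDl mul1r.
have {1}-> : 4 * cnorm a = 2^-1 * (2 * (2 * cnorm a) + 2 * (2 * cnorm a)) by field.
rewrite {1}aE nh [leRHS]rmorphM ler_wpM2l ?(lecR 0) ?invr_ge0// tD rmorphD.
rewrite (le_trans (ler_normD _ _))// lerD//.
  by rewrite (le_trans (its_sa_bounded xS))// lecR ler_wpM2l.
rewrite tZ normrM normrN ni mul1r (le_trans (its_sa_bounded yS))// lecR.
by rewrite ler_wpM2l.
Qed.

Lemma its_partial j (a : smooth_alg T) : tau (torus_partial j (a : T)) = 0.
Proof.
have [t0 tD tZ] := its_linear0_D_Z.
set b := torus_partial j _.
have bc : norm_cvg 0^' (diff_quotient (orbit_map (a : T)) j 0) b.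
  have := @smooth_is_partial _ _ _ T j a 0.
  by rewrite {2}/orbit_map gauge0.
have tq h : tau (diff_quotient (orbit_map (a : T)) j 0 h) = 0.
  rewrite /diff_quotient tZ tD -scaleN1r tZ mulN1r /orbit_map !its_gauge.
  by rewrite subrr mulr0.
apply/eqP; rewrite -normr_eq0; apply/eqP; set r := complex.Re `|tau b|.
have rE : `|tau b| = r%:C by rewrite /r normc_def.
have r_le e : 0 < e -> r <= 4 * e.
  move=> e0; have /cvgrPdist_lt/(_ e e0) := bc.
  move=> /filter_ex[h] /=; rewrite sub0r normrN ger0_norm ?cnorm_ge0// => he.
  rewrite -lecR -rE; have -> : tau b = tau (b - diff_quotient (orbit_map (a : T)) j 0 h).
    by rewrite tD -scaleN1r tZ tq mulr0 addr0.
  by rewrite (le_trans (its_bounded _))// lecR ler_wpM2l// cdistC ltW.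
rewrite rE; congr (_%:C); apply: le_anti; apply/andP; split.
  by apply/ler_addgt0Pl => e e0; rewrite addr0 (le_trans (r_le (e / 4) _)) ?divr_gt0// mulrC divfK.
by rewrite -lecR -rE; exact: normr_ge0.
Qed.

Definition smooth_trace : trace (smooth_alg T) :=
  @Trace R (smooth_alg T) (fun a : smooth_alg T => tau (a : T))
    (fun c (a b : smooth_alg T) => @its_linear _ _ _ _ tau c (a : T) (b : T))
    (fun a b : smooth_alg T => itsC tau (a : T) (b : T)).

Lemma smooth_trace_der0 : generically_transcendental T ->
  forall (X : starDer (smooth_alg T)) (a : smooth_alg T), smooth_trace (X a) = 0.
Proof.
have [t0 tD tZ] := linear0_D_Z_trace smooth_trace.
move=> [_ span] X a; have [c [Z [b Zb] ->]] := span X.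
have -> : (\sum_j c j *: partial_der T j + Z) a
        = \sum_j (c j)%:C *: smooth_partial j a + Z a.
  rewrite -[LHS]/((\sum_j c j *: partial_der T j) a + Z a); congr (_ + _).
  elim/big_rec2: _ => // j x d _ <-.
  by [].
rewrite tD Zb tD -scaleN1r tZ mulN1r traceC subrr addr0.
elim/big_rec: _ => // j x _ x0; rewrite tD x0 addr0 tZ.
by rewrite -[smooth_trace _]/(tau (torus_partial j (a : T))) its_partial mulr0.
Qed.

End SmoothTrace.

(* Main.v *)
Require Import Defs.
From mathcomp Require Import all_boot all_order all_algebra.
From mathcomp Require Import all_classical all_reals all_analysis.
From mathcomp Require Import complex ssrAC.
Import GRing.Theory.
Local Open Scope ring_scope.

Set Implicit Arguments.
Unset Strict Implicit.

(** Inner derivations form an ideal: $[\operatorname{ad}_a, X] = -\operatorname{ad}_{X\cdot a}$,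
    where $X\cdot a$ stays in $\mathfrak g$ because the trace kills the image of every *-derivation.
    Substituting the formula for [nabla (ad a)] into the curvature, the Leibniz rule produces
    $(X\cdot a)Y$, which the bracket term cancels, and what survives is $[\nabla_X,\mu(a)] -
    \mu(X\cdot a)$ ([curvature_ad]). For $X = \operatorname{ad}_b$ this becomes $[\mu(b),\mu(a)] -
    \mu([b,a])$ ([curvature_ad_ad]), the defect of $\mu$ from being a Lie homomorphism. *)

Section CurvatureOnInnerDerivations.
Variables (R : realType) (A : starAlgType R) (n : nat).
Implicit Types (X : starDer A) (Y : 'rV[A]_n).

Lemma nablaN (nabla : connection A n) X Y : nabla (- X) Y = - nabla X Y.
Proof.
have m1 : (-1 : R)%:C%C%:A = -1 :> A by rewrite rmorphN1 scaleN1r.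
have nabla0 : nabla 0 Y = 0.
  have := nabla_linearl nabla (-1) 0 0 Y.
  by rewrite scaler0 addr0 m1 scaleN1r addNr.
have := nabla_linearl nabla (-1) X 0 Y.
by rewrite m1 !scaleN1r !addr0 nabla0 addr0.
Qed.

Variables (tau : trace A) (tauX : forall X (b : A), tau (X b) = 0).
Implicit Types a b : skew_traceless tau.

Lemma der_bracket_ad a X : der_bracket (ad a) X = - ad (der_act tauX X a).
Proof.
apply: starDer_ext => b /=.
rewrite fctE /=.
have [_ XD XZ] := linear0_D_Z (starDer_linear X).
have XN c : X (- c) = - X c by rewrite -scaleN1r XZ scaleN1r.
rewrite XD XN !starDerM !opprD !opprK !addrA.
(* The terms $a\,X(b)$ and $X(b)\,a$ cancel, leaving $b\,X(a) - X(a)\,b$. *)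
by rewrite (ACl (1*4*2*5*3*6)) /= subrr add0r addNr add0r.
Qed.

Variables (nabla : connection A n)
  (mu : skew_traceless tau -> {linear 'rV[A]_n -> 'rV[A]_n}).
Hypothesis nabla_ad : forall a Y, nabla (ad a) Y = val a *: Y + mu a Y.

Lemma nablaDr X Y Y' : nabla X (Y + Y') = nabla X Y + nabla X Y'.
Proof.
by have := nabla_linearr nabla 1 X Y Y'; rewrite rmorph1 !scale1r.
Qed.

Lemma curvature_ad a X Y :
  curvature nabla (ad a) X Y
  = commutator (nabla X) (mu a) Y - mu (der_act tauX X a) Y.
Proof.
rewrite /curvature /commutator der_bracket_ad nablaN !nabla_ad nablaDr.
rewrite nabla_leibniz /= !opprD !addrA.
(* Two pairs cancel: $(X\cdot a)Y$ from Leibniz against the bracket term, and $a\nabla_X Y$ against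
   itself. *)
by rewrite (ACl (1*6*2*4*3*5*7)) /= subrr add0r subrr add0r.
Qed.

(** Being a module endomorphism, [mu a] commutes with multiplication by $b$, so only the [mu b] part
    of [nabla (ad b)] contributes to the commutator. *)
Lemma curvature_ad_ad a b Y :
  curvature nabla (ad a) (ad b) Y
  = commutator (mu b) (mu a) Y - mu (skew_bracket b a) Y.
Proof.
(* [der_act tauX (ad b) a] and [skew_bracket b a] both have underlying element $ba - ab$. *)
rewrite curvature_ad; congr (_ - _); last by congr (mu _ _); exact: val_inj.
by rewrite /commutator !nabla_ad linearD linearZ opprD addrACA subrr add0r.
Qed.

End CurvatureOnInnerDerivations.

Theorem proposition2 (R : realType) (n : nat) (Theta : 'M[R]_n)
    (Theta_skew : Theta^T = - Theta)
    (A : nctorus Theta)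
    (A_gt : generically_transcendental A)
    (tau : invariant_tracial_state A)
    (nabla : connection (smooth_alg A) n)
    (mu : skew_traceless (smooth_trace tau) ->
          {linear 'rV[smooth_alg A]_n -> 'rV[smooth_alg A]_n})
    (mu_linear : real_linear_to_End mu)
    (nabla_ad : forall (a : skew_traceless (smooth_trace tau))
                       (Y : 'rV[smooth_alg A]_n),
        nabla (ad a) Y = val a *: Y + mu a Y) :
  (forall (X : starDer (smooth_alg A)) (a : skew_traceless (smooth_trace tau))
          (Y : 'rV[smooth_alg A]_n),
      curvature nabla (ad a) X Y
      = commutator (nabla X) (mu a) Y
        - mu (der_act (smooth_trace_der0 tau A_gt) X a) Y) /\
  ((forall (a b : skew_traceless (smooth_trace tau)) (Y : 'rV[smooth_alg A]_n),
      curvature nabla (ad a) (ad b) Y = 0) <->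
   (forall (a b : skew_traceless (smooth_trace tau)) (Y : 'rV[smooth_alg A]_n),
      mu (skew_bracket a b) Y = commutator (mu a) (mu b) Y)).
Proof.
have tauX := smooth_trace_der0 tau A_gt.
split=> [X a Y|]; first exact: curvature_ad.
split=> [flat a b Y|hom a b Y].
  (* The arguments are swapped since [curvature_ad_ad] reverses their order. *)
  have /eqP := flat b a Y.
  by rewrite (curvature_ad_ad tauX nabla_ad) subr_eq0 => /eqP <-.
by rewrite (curvature_ad_ad tauX nabla_ad) hom subrr.
Qed.
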